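(* For integers $n,k\ge 0$ let $g(n,k)$ denote the number of $k$-faces of the arrangement $I(\mathfrak{gl}_n,V\oplus\bigwedge^2)$. Then, as formal power series, \[ G(s,t)=\sum_{n,k\ge 0} g(n,k)\,s^n t^k=\frac{1-s}{1-2s+s^2-2st+s^2t}. \]
   Context: Identify the diagonal Cartan subalgebra of $\mathfrak{gl}_n$ with $\mathbb{R}^n$ with coordinates $x_1,\dots,x_n$. Let $W=\{x\in\mathbb{R}^n: x_1\ge x_2\ge\cdots\ge x_n\}$ be the closed (dual fundamental) Weyl chamber and $W^0=\{x_1>\cdots>x_n\}$ its interior. For $1\le i\le j\le n$ let $\lambda_{i,j}=x_i+x_j$ and $\lambda_{i,j}^\perp$ its kernel (for $i=j$ this is the hyperplane $x_i=0$). These are the kernels of the weights of $V\oplus\bigwedge^2V$, $V$ the vector representation, and $I(\mathfrak{gl}_n,V\oplus\bigwedge^2)$ is the arrangement of these hyperplanes restricted to $W$. Its chambers are the closures of the connected components of $W^0\setminus\bigcup_{i\le j}\lambda_{i,j}^\perp$ (polyhedral cones); a face is a chamber or the intersection of a chamber with a supporting hyperplane of it; a $k$-face is a face whose linear span has dimension $k$. (For $n=0$ the only face is the origin.) *)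

(* Defs.v *)
From HB Require Import structures.
From mathcomp Require Import all_boot all_order all_algebra.
From mathcomp Require Import all_classical all_reals all_analysis.
Set Implicit Arguments. Unset Strict Implicit. Unset Printing Implicit Defensive.
Import Order.TTheory GRing.Theory Num.Theory.
Import numFieldNormedType.Exports.
Local Open Scope classical_set_scope.
Local Open Scope ring_scope.

(* Points of R^n are row vectors x : 'rV[R]_n, coordinate x_i = x ord0 i
   (indices 0..n-1 instead of 1..n). *)

Definition dotv (R : realType) (n : nat) (a x : 'rV[R]_n) : R :=
  \sum_(i < n) a ord0 i * x ord0 i.

(* interior of the Weyl chamber minus the hyperplanes x_i + x_j = 0 (i <= j) *)
Definition open_part (R : realType) (n : nat) : set 'rV[R]_n :=
  [set x | (forall i j : 'I_n, (i < j)%N -> x ord0 j < x ord0 i) /\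
           (forall i j : 'I_n, (i <= j)%N -> x ord0 i + x ord0 j != 0)].

Definition is_chamber (R : realType) (n : nat) (C : set 'rV[R]_n) : Prop :=
  exists2 x, @open_part R n x & C = closure (connected_component (@open_part R n) x).

Definition is_face (R : realType) (n : nat) (F : set 'rV[R]_n) : Prop :=
  exists2 C, is_chamber C &
    (F = C \/ exists a : 'rV[R]_n, [/\ a != 0,
        (forall x, C x -> 0 <= dotv a x) &
        F = C `&` [set x | dotv a x = 0]]).

Definition span_dim (R : realType) (n : nat) (S : set 'rV[R]_n) (k : nat) : Prop :=
  exists U : {vspace 'rV[R]_n},
    [/\ (forall x, S x -> x \in U),
        (forall V : {vspace 'rV[R]_n}, (forall x, S x -> x \in V) -> (U <= V)%VS) &
        \dim U = k].

Definition is_kface (R : realType) (n k : nat) (F : set 'rV[R]_n) : Prop :=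
  is_face F /\ span_dim F k.

Definition kface_count (R : realType) (n k m : nat) : Prop :=
  exists f : 'I_m -> set 'rV[R]_n,
    injective f /\ (forall F, @is_kface R n k F <-> exists i, F = f i).

(* formal power series in s, t as coefficient arrays; Cauchy product *)
Definition ps_mul (A B : nat -> nat -> int) (n k : nat) : int :=
  \sum_(i < n.+1) \sum_(j < k.+1) A i j * B (n - i)%N (k - j)%N.

Definition ps_num (n k : nat) : int :=
  match n, k with
  | 0, 0 => 1 | 1, 0 => -1 | _, _ => 0 end.

Definition ps_den (n k : nat) : int :=
  match n, k with
  | 0, 0 => 1 | 1, 0 => -2 | 2, 0 => 1 | 1, 1 => -2 | 2, 1 => 1 | _, _ => 0 end.

(* Main.v *)
(* Every chamber is a chamber of the hyperplane arrangement of type B_n, cut out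
   by the forms ±x_i ± x_j, that lies in the Weyl chamber. Hence the faces are the
   sets cone(q), for q in the Weyl chamber, of the points x with f(x) >= 0 for each
   of these forms f with f(q) >= 0, and cone(q) only depends on the signs of the
   f(q). Each sign pattern has a unique normal form: replacing |q_i| by its rank
   among 0 and the absolute values of the coordinates yields a weakly decreasing
   integer sequence r with {0} U {|r_i|} = {0, ..., k}, and the span of the face
   then has dimension k. Such sequences are built by adding an entry k at the front
   or, when k does not occur, an entry -k at the end, which gives the recurrence
   encoded by the denominator of the generating function. *)
Require Import Defs.
From HB Require Import structures.
From mathcomp Require Import all_boot all_order all_algebra.
From mathcomp Require Import all_classical all_reals all_analysis.
From mathcomp Require Import zify lra.
Set Implicit Arguments. Unset Strict Implicit. Unset Printing Implicit Defensive.
Import Order.TTheory GRing.Theory Num.Theory.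
Import numFieldNormedType.Exports.
Local Open Scope classical_set_scope.
Local Open Scope ring_scope.

(** * Bilinearity and continuity of the standard pairing *)

Section DotV.
Context (R : realType) (n : nat).
Implicit Types a b x y : 'rV[R]_n.

Lemma dotvC a x : dotv a x = dotv x a.
Proof. by apply: eq_bigr => i _; rewrite mulrC. Qed.

Lemma dotvDr a x y : dotv a (x + y) = dotv a x + dotv a y.
Proof. by rewrite -big_split; apply: eq_bigr => i _; rewrite mxE mulrDr. Qed.

Lemma dotvZr a c x : dotv a (c *: x) = c * dotv a x.
Proof. by rewrite [RHS]mulr_sumr; apply: eq_bigr => i _; rewrite mxE mulrCA. Qed.

Lemma dotvNr a x : dotv a (- x) = - dotv a x.
Proof. by rewrite -scaleN1r dotvZr mulN1r. Qed.

Lemma dotv0r a : dotv a 0 = 0.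
Proof. by rewrite -(scale0r 0) dotvZr mul0r. Qed.

Lemma dotvNl a x : dotv (- a) x = - dotv a x.
Proof. by rewrite dotvC dotvNr dotvC. Qed.

Lemma dotv0l x : dotv 0 x = 0.
Proof. by rewrite dotvC dotv0r. Qed.

Lemma dotv_suml (J : Type) (s : seq J) (P : pred J) (F : J -> 'rV[R]_n) x :
  dotv (\sum_(i <- s | P i) F i) x = \sum_(i <- s | P i) dotv (F i) x.
Proof.
apply: (big_morph (fun v => dotv v x)); last exact: dotv0l.
by move=> a b; rewrite dotvC dotvDr !(dotvC x).
Qed.

Lemma dotv_continuous a : continuous (dotv a).
Proof.
rewrite /dotv; apply: (@continuous_big R^o 'I_n +%R 0 xpredT _ _ (index_enum _)
  (fun i x => a ord0 i * x ord0 i)) => [|i _ x].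
  by move=> x; apply: cvgD; [exact: cvg_fst|exact: cvg_snd].
exact: (cvgM (cvg_cst _) (@coord_continuous _ _ _ _ _ x)).
Qed.

End DotV.

(** * Faces and chambers of a central arrangement whose family of forms is closed under negation *)

Section Arrangement.
Context (R : realType) (n : nat) (I : finType) (h : I -> 'rV[R]_n).
Context (hN : forall e, exists e', h e' = - h e).
Implicit Types p q x : 'rV[R]_n.

(* The closed face of the arrangement with [q] in its relative interior: as the
   family [h] is symmetric, [dotv (h e) q = 0] imposes [dotv (h e) x = 0]. *)
Definition cone q : set 'rV[R]_n :=
  [set x | forall e, 0 <= dotv (h e) q -> 0 <= dotv (h e) x].

(** Zero members are exempt because the family [form] used later contains 0, as x_i - x_i. *)
Definition regular : set 'rV[R]_n :=
  [set x | forall e, h e != 0 -> dotv (h e) x != 0].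

Lemma cone_le0 q x e : cone q x -> dotv (h e) q <= 0 -> dotv (h e) x <= 0.
Proof.
move=> qx; have [e' ee'] := hN e.
by have := qx e'; rewrite ee' !dotvNl !oppr_ge0.
Qed.

Lemma cone_eq0 q x e : cone q x -> dotv (h e) q = 0 -> dotv (h e) x = 0.
Proof.
move=> qx q0; apply/eqP; rewrite eq_le (cone_le0 qx) ?q0 //.
by apply: qx; rewrite q0.
Qed.

Lemma cone_lt0 q x e : cone q x -> dotv (h e) x < 0 -> dotv (h e) q < 0.
Proof. by move=> qx; rewrite !ltNge; apply: contraNN; exact: qx. Qed.

Lemma cone_refl q : cone q q. Proof. by []. Qed.

Lemma cone_sub q x : cone q x -> cone x `<=` cone q.
Proof. by move=> qx y xy e /qx /xy. Qed.

Lemma coneD q x y : cone q x -> cone q y -> cone q (x + y).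
Proof. by move=> qx qy e he; rewrite dotvDr addr_ge0 ?qx ?qy. Qed.

(* Adding 1 to the sum keeps the inverse positive when all the slopes vanish;
   indices with [dotv (h e) q = 0] contribute junk quotients equal to 0. *)
Lemma perturb q x : exists2 c : R, 0 < c &
  forall e, 0 < dotv (h e) q -> 0 < dotv (h e) (q + c *: x).
Proof.
pose s := \sum_e `|dotv (h e) x / dotv (h e) q|.
have s0 : 0 <= s by apply: sumr_ge0.
have s1 : 0 < 1 + s by rewrite ltr_pwDl.
exists (1 + s)^-1; first by rewrite invr_gt0.
move=> e he; rewrite dotvDr dotvZr.
have : `|dotv (h e) x / dotv (h e) q| < 1 + s.
  by rewrite /s (bigD1 e) //= addrCA ltrDl ltr_pwDl // sumr_ge0.
rewrite normrM normfV (gtr0_norm he) ltr_pdivrMr // => H.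
rewrite -(pmulr_rgt0 _ s1) mulrDr mulrA divff ?gt_eqF // mul1r.
by have := lerNnormlW (lexx `|dotv (h e) x|); rewrite -subr_gt0 in H *; lra.
Qed.

(** Forms positive at [q] stay positive for small [c] and those vanishing at [q] stay zero, so [q]
    is a relative interior point of [cone q]. *)
Lemma perturb_cone q x : (forall e, dotv (h e) q = 0 -> dotv (h e) x = 0) ->
  exists2 c : R, 0 < c & cone q (q + c *: x).
Proof.
move=> q0; have [c c0 H] := perturb q x; exists c => // e.
rewrite le_eqVlt => /orP[/eqP/esym qe|/H/ltW//].
by rewrite dotvDr dotvZr qe q0 // mulr0 addr0.
Qed.

(** Take [q] in the cut-out set with as many nonzero forms as possible: it is a relative interior
    point, so its signs determine the set. *)
Lemma regular_face p a : regular p -> (forall x, cone p x -> 0 <= dotv a x) ->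
  exists2 q, cone p q & cone p `&` [set x | dotv a x = 0] = cone q.
Proof.
move=> rp ap.
pose A q := cone p q /\ dotv a q = 0.
pose N q := #|[pred e | dotv (h e) q != 0]|.
have A0 : A 0 by split; [move=> e _|]; rewrite dotv0r.
have [q [Aq maxq]] : exists q, A q /\ forall x, A x -> (N x <= N q)%N.
  have Nle x : (N x <= #|I|)%N by exact: max_card.
  have ex : exists m, `[< exists2 x, A x & N x = m >].
    by exists (N 0); apply/asboolP; exists 0.
  have ub m : `[< exists2 x, A x & N x = m >] -> (m <= #|I|)%N.
    by move=> /asboolP[x _ <-].
  case: (ex_maxnP ex ub) => m /asboolP[q Aq Nq] Hm.
  exists q; split=> // x Ax; rewrite Nq; apply: Hm; apply/asboolP; by exists x.
have [pq aq] := Aq.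
exists q => //; apply/seteqP; split=> [x [px ax] e qe|x qx].
  apply: contraT; rewrite -ltNge => xe.
  have pe := cone_lt0 px xe.
  have q0 : dotv (h e) q = 0.
    by apply/eqP; rewrite eq_le qe andbT (cone_le0 pq) // ltW.
  (* On the cut-out set every form has weakly the sign it has at [p], so nothing cancels in q + x:
     all forms nonzero at [q] remain so and [e] is a new one, against maximality. *)
  have : A (q + x) by split; [exact: coneD|rewrite dotvDr aq add0r].
  move=> /maxq; rewrite leqNgt => /negP[]; apply: proper_card.
  apply/properP; split.
    apply/fintype.subsetP => f; rewrite !inE dotvDr => qf.
    have [e' ee'] := hN f.
    case: (ltgtP (dotv (h f) p) 0) => pf; last by rewrite (cone_eq0 pq pf) eqxx in qf.
      have := cone_le0 pq (ltW pf); have := cone_le0 px (ltW pf).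
      by move=> ? ?; rewrite lt_eqF // -[ltRHS]addr0 ltr_leD // lt_neqAle qf.
    have := pq f (ltW pf); have := px f (ltW pf).
    by move=> ? ?; rewrite gt_eqF // -[ltLHS]addr0 ltr_leD // lt_neqAle eq_sym qf.
  by exists e; rewrite !inE ?dotvDr q0 ?eqxx // add0r lt_eqF.
have px := cone_sub pq qx; split=> //=.
apply/eqP; rewrite eq_le ap // andbT.
(* From [q] one can move a little along - x inside the cone; since [a] stays nonnegative there, it
   is at most 0 at [x]. *)
have [|c c0 qc] := @perturb_cone q (- x).
  by move=> e /(cone_eq0 qx); rewrite dotvNr => ->; rewrite oppr0.
have := ap _ (cone_sub pq qc).
by rewrite dotvDr aq add0r dotvZr dotvNr mulrN oppr_ge0 pmulr_rle0.
Qed.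

(** The sum [a] of the forms positive at [p] and zero at [q] has only nonnegative terms on [cone p],
    so it vanishes exactly where each of them does. If [a] is 0, the two cones agree. *)
Lemma face_of_regular p q : regular p -> cone p q ->
  cone q = cone p \/ exists a, [/\ a != 0, (forall x, cone p x -> 0 <= dotv a x)
    & cone q = cone p `&` [set x | dotv a x = 0]].
Proof.
move=> rp pq.
pose P e := (0 < dotv (h e) p) && (dotv (h e) q == 0).
pose a := \sum_(e | P e) h e.
have ax x : cone p x -> 0 <= dotv a x.
  move=> px; rewrite /a dotv_suml sumr_ge0 // => e /andP[/ltW pe _]; exact: px.
have qP : cone q = cone p `&` [set x | dotv a x = 0].
  apply/seteqP; split=> [x qx|x [px]].
    split; first exact: cone_sub pq _ qx.
    by rewrite /= /a dotv_suml big1 // => e /andP[_ /eqP]; exact: cone_eq0.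
  rewrite /= /a dotv_suml => /eqP; rewrite psumr_eq0; last first.
    by move=> e /andP[/ltW pe _]; exact: px.
  move=> /allP a0 e qe.
  have [pe|pe] := leP 0 (dotv (h e) p); first exact: px.
  have q0 : dotv (h e) q = 0.
    by apply/eqP; rewrite eq_le qe andbT (cone_le0 pq) // ltW.
  have [e' ee'] := hN e.
  have := a0 e' (mem_index_enum _).
  by rewrite /P ee' !dotvNl q0 oppr0 eqxx oppr_gt0 pe /= oppr_eq0 => /eqP ->.
have [a0|a0] := eqVneq a 0; last by right; exists a.
left; rewrite qP a0; apply/seteqP; split=> x; first by case.
by split=> //=; rewrite dotv0l.
Qed.

(** Moving from [q] a little along a regular [r] breaks all ties. The last clause serves to keep [p]
    in the Weyl chamber. *)
Lemma regular_perturb q r : regular r -> exists p, [/\ regular p, cone p q &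
  forall e, 0 <= dotv (h e) q -> 0 <= dotv (h e) r -> 0 <= dotv (h e) p].
Proof.
move=> rr; have [c c0 H] := perturb q r; exists (q + c *: r).
have H' e : dotv (h e) q < 0 -> dotv (h e) (q + c *: r) < 0.
  have [e' ee'] := hN e.
  by have := H e'; rewrite ee' !dotvNl !oppr_gt0.
split=> [e he|e|e qe re].
- case: (ltgtP (dotv (h e) q) 0) => [/H'/lt_eqF->|/H/gt_eqF->|q0] //.
  by rewrite dotvDr dotvZr q0 add0r mulf_neq0 //; [rewrite gt_eqF|exact: rr].
- by apply: contraTT; rewrite -!ltNge; exact: H'.
- by rewrite dotvDr dotvZr addr_ge0 // mulr_ge0 // ltW.
Qed.

Lemma line_continuous p x : continuous (fun t : R => p + t *: x).
Proof.
move=> t; apply: cvgD; first exact: cvg_cst.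
by apply: cvgZl; exact: cvg_id.
Qed.

Lemma cone_closed p : closed (cone p).
Proof.
have -> : cone p = \bigcap_(e in [set e | 0 <= dotv (h e) p])
    (dotv (h e) @^-1` [set y | 0 <= y]).
  by apply/seteqP; split=> x px e; exact: px.
apply: closed_bigI => e _; apply: closed_comp; last exact: closed_ge.
by move=> x _; exact: dotv_continuous.
Qed.

(** No nonzero form vanishes on [A], so by connectedness each keeps on the component the sign it has
    at [p]. Conversely, the points where all forms positive at [p] are positive form a convex subset
    of [A], hence of the component. *)
Lemma closure_component (A : set 'rV[R]_n) p :
  A p -> A `<=` regular ->
  (forall x, (forall e, 0 < dotv (h e) p -> 0 < dotv (h e) x) -> A x) ->
  closure (connected_component A p) = cone p.
Proof.
move=> Ap Ar opA; have rp := Ar _ Ap.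
apply/seteqP; split.
  rewrite [X in _ `<=` X](closure_id _).1; last exact: cone_closed.
  apply: closure_subset => x [C [Cp CA Cc] Cx] e pe.
  have [he|he] := eqVneq (h e) 0; first by rewrite he dotv0l.
  have : is_interval (dotv (h e) @` C).
    apply/connected_intervalP; apply: connected_continuous_connected => //.
    by apply: continuous_subspaceT; exact: dotv_continuous.
  move=> Hi; rewrite leNgt; apply/negP => xe.
  have : (dotv (h e) @` C) 0.
    by apply: (Hi (dotv (h e) x) (dotv (h e) p)); [exists x|exists p|rewrite pe ltW].
  by move=> [y Cy ye]; have := Ar _ (CA _ Cy) e he; rewrite ye eqxx.
pose O := [set x | forall e, 0 < dotv (h e) p -> 0 < dotv (h e) x].
have Oc : O `<=` connected_component A p.
  move=> x Ox.
  exists ((fun t : R => p + t *: (x - p)) @` `[0, 1]); last first.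
    by exists 1; rewrite /= ?in_itv /= ?ler01 ?lexx // scale1r addrC subrK.
  split.
  - by exists 0; rewrite /= ?in_itv /= ?ler01 ?lexx // scale0r addr0.
  - move=> _ [t /= + <-]; rewrite in_itv /= => /andP[t0 t1]; apply: opA => e pe.
    rewrite dotvDr dotvZr dotvDr dotvNr.
    have xe := Ox e pe.
    case: (ltgtP t 0) t0 => // [t0 _|-> _]; last by rewrite mul0r addr0.
    have -> : dotv (h e) p + t * (dotv (h e) x - dotv (h e) p) =
       (1 - t) * dotv (h e) p + t * dotv (h e) x by lra.
    by rewrite ltr_wpDl ?mulr_gt0 // mulr_ge0 ?subr_ge0 // ltW.
  - apply: connected_continuous_connected.
      by apply/connected_intervalP; exact: interval_is_interval.
    by apply: continuous_subspaceT; exact: line_continuous.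
(* A point [x] of the cone is the limit of x + t p as t decreases to 0, and these points lie in [O]
   for t > 0. *)
move=> x px B /= Bx.
have := @line_continuous x p 0; rewrite /continuous_at scale0r addr0 => /(_ _ Bx).
move=> /nbhs_ballP[d /= d0 /(_ (d / 2))].
rewrite /ball /= sub0r normrN gtr0_norm ?divr_gt0 // => H.
exists (x + (d / 2) *: p); split; last by apply: H; lra.
apply: Oc => e pe; rewrite dotvDr dotvZr ltr_wpDl ?px ?mulr_gt0 ?divr_gt0 //.
exact: ltW.
Qed.

End Arrangement.

(** * Signed rank sequences and their enumeration *)

(** Rank 0 is reserved for the value 0 whether or not a coordinate vanishes, so only the levels from
    1 to k are required to occur. *)
Definition signed_ranks (n k : nat) (r : seq int) : bool :=
  [&& size r == n, sorted >=%R r, all (fun x => absz x <= k)%N r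
    & all (fun c => c \in map absz r) (iota 1 k)].

Lemma signed_ranksP n k r : reflect
  [/\ size r = n, sorted >=%R r, forall x, x \in r -> (absz x <= k)%N
    & forall c, (0 < c <= k)%N -> c \in map absz r] (signed_ranks n k r).
Proof.
apply: (iffP and4P) => -[]; [move=> /eqP ? ? /allP ? /allP H|move=> -> ? /allP ? H].
  by split=> // c hc; apply: H; rewrite mem_iota; lia.
split=> //; apply/allP => c; rewrite mem_iota => hc; apply: H; lia.
Qed.

(* A nonempty sequence in which [k] occurs begins with [k], and one in which it does
   not ends with [- k]; the second component lists the latter. *)
Fixpoint enum_signed_ranks (n k : nat) : seq (seq int) * seq (seq int) :=
  match n with
  | 0 => (if k == 0 then [:: [::]] else [::], [::])
  | n'.+1 =>
    let below := if k is k'.+1 then (enum_signed_ranks n' k').1 else [::] in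
    let neg := [seq rcons r (- k%:Z) | r <- (enum_signed_ranks n' k).2 ++ below] in
    ([seq k%:Z :: r | r <- (enum_signed_ranks n' k).1 ++ below] ++ neg, neg)
  end.

Lemma sorted_ge_cons (k : nat) (r : seq int) :
  (forall x, x \in r -> (absz x <= k)%N) -> sorted >=%R (k%:Z :: r) = sorted >=%R r.
Proof.
move=> H; rewrite /= path_sortedE; last by move=> a b c /= ? ?; lia.
case: (sorted _ r); rewrite ?andbF // andbT; apply/allP => x /H /=; lia.
Qed.

Lemma sorted_ge_rcons (k : nat) (r : seq int) :
  (forall x, x \in r -> (absz x <= k)%N) -> sorted >=%R (rcons r (- k%:Z)) = sorted >=%R r.
Proof.
move=> H; rewrite -cats1 sorted_pairwise; last by move=> a b c /= ? ?; lia.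
rewrite pairwise_cat /= andbT -sorted_pairwise; last by move=> a b c /= ? ?; lia.
rewrite andbC; case: (sorted _ r) => //=; rewrite allrel1r.
apply/allP => x /H /=; lia.
Qed.

(** Once an entry of absolute value k is removed, either level k still occurs or it is lost and the
    top level is k - 1. The permutation covers insertion both at the front and at the end. *)
Lemma signed_ranks_extend (k : nat) (r r' : seq int) (x : int) :
  absz x = k -> perm_eq r' (x :: r) ->
  sorted >=%R r' = sorted >=%R r ->
  signed_ranks (size r).+1 k r' =
    signed_ranks (size r) k r || (if k is k'.+1 then signed_ranks (size r) k' r else false).
Proof.
move=> xk pr sr.
have mr : r' =i x :: r by exact: perm_mem.
have amr c : (c \in map absz r') = (c == k) || (c \in map absz r).
  by rewrite -xk -in_cons; exact: (perm_mem (perm_map absz pr)).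
have -> : signed_ranks (size r).+1 k r' = [&& sorted >=%R r, all (fun x => absz x <= k)%N r
    & all (fun c => c \in map absz r) (iota 1 k.-1)].
  rewrite /signed_ranks (perm_size pr) /= eqxx /= sr; congr andb.
  rewrite (eq_all_r mr) /= xk leqnn /=; congr andb.
  apply/allP/allP => H c; rewrite mem_iota => hc.
    by have := H c; rewrite mem_iota amr; case: eqP => /= [?|_]; [lia|apply; lia].
  rewrite amr; case: eqP => //= ck; apply: H; rewrite mem_iota; lia.
rewrite /signed_ranks eqxx /=.
case: (sorted _ r) => /=; last by case: (k).
case: k xk amr => [|k] xk amr; first by rewrite /= !andbT orbF.
rewrite -[k.+1.-1]/k.
apply/idP/idP => [/andP[/allP H1 /allP H2]|].
  have [kr|kr] := boolP (k.+1 \in map absz r).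
    apply/orP; left; apply/andP; split; first exact/allP.
    apply/allP => c; rewrite mem_iota => hc.
    have [->//|ck] := eqVneq c k.+1.
    by apply: H2; rewrite mem_iota; lia.
  apply/orP; right; apply/andP; split; last exact/allP.
  apply/allP => y yr; have := H1 y yr.
  have : absz y != k.+1 by apply: contraNneq kr => <-; exact: map_f.
  lia.
move=> /orP[/andP[-> /allP H]|/andP[/allP H ->]].
  apply/allP => c; rewrite mem_iota => hc.
  by apply: H; rewrite mem_iota; lia.
rewrite andbT; apply/allP => y /H; lia.
Qed.

(** For k = 0 the entries k and - k coincide; [0 < k] in the second claim keeps the zero sequence
    from being listed twice. *)
Lemma mem_enum_signed_ranks n k r :
  (r \in (enum_signed_ranks n k).1) = signed_ranks n k r /\
  (r \in (enum_signed_ranks n k).2) = [&& signed_ranks n k r, (0 < k)%N & k%:Z \notin r].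
Proof.
elim: n k r => [|n IH] k r.
  rewrite /= /signed_ranks size_eq0.
  case: k => [|k]; case: r => [|x r] //=.
set below := if k is k'.+1 then (enum_signed_ranks n k').1 else [::].
have belowE s : (s \in below) = (if k is k'.+1 then signed_ranks n k' s else false).
  by rewrite /below; case: (k) => // k'; rewrite (IH k' s).1.
have size_signed_ranks m l s : signed_ranks m l s -> size s = m by move=> /signed_ranksP[].
have le_signed_ranks s :
    signed_ranks n k s || (if k is k'.+1 then signed_ranks n k' s else false) ->
    forall x, x \in s -> (absz x <= k)%N.
  move=> /orP[/signed_ranksP[]//|]; case: (k) => // k' /signed_ranksP[_ _ H _] x /H; lia.
have negE : (r \in (enum_signed_ranks n.+1 k).2) =
    [&& signed_ranks n.+1 k r, (0 < k)%N & k%:Z \notin r].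
  rewrite /= -/below.
  apply/mapP/and3P => [[s]|[cr k0 kr]].
    rewrite mem_cat (IH k s).2 belowE => hs ->.
    have hs' : signed_ranks n k s || (if k is k'.+1 then signed_ranks n k' s else false).
      by case/orP: hs => [/and3P[->]|->]; rewrite ?orbT.
    have [k0 ks] : (0 < k)%N /\ k%:Z \notin s.
      case/orP: hs => [/and3P[]//|]; case: (k) => // k' /signed_ranksP[_ _ H _].
      by split=> //; apply/negP => /H /=; lia.
    have sz : size s = n.
      by case/orP: hs' => [/size_signed_ranks//|]; case: (k) => // k' /size_signed_ranks.
    split=> //.
      rewrite -sz (signed_ranks_extend (r := s) (x := - k%:Z)) ?sz ?abszN ?perm_rcons //.
      by rewrite sorted_ge_rcons //; exact: le_signed_ranks.
    rewrite mem_rcons inE negb_or ks andbT; lia.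
  have /signed_ranksP[sr tr ler hr] := cr.
  have : k \in map absz r by apply: hr; lia.
  case/mapP => z zr kz.
  have {kz} zk : z = - k%:Z.
    have : z != k%:Z by apply: contraNneq kr => <-.
    lia.
  move: cr kr sr tr ler zr; rewrite {}zk; case/lastP: r {hr} => // s y cr kr sr tr ler zr.
  (* The last entry is the least one; since - k occurs and no absolute value exceeds k, it equals -
     k. *)
  have yk : y = - k%:Z.
    have := ler y; rewrite mem_rcons mem_head => /(_ isT).
    move: tr; rewrite -cats1 sorted_pairwise; last by move=> a b c /= ? ?; lia.
    rewrite pairwise_cat allrel1r => /and3P[/allP H _ _].
    move: zr; rewrite mem_rcons inE => /orP[/eqP//|/H /=]; lia.
  rewrite {y}yk in cr kr sr tr ler zr *; exists s => //.
  have sz : size s = n by move: sr; rewrite size_rcons => -[].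
  have les x : x \in s -> (absz x <= k)%N.
    by move=> xs; apply: ler; rewrite mem_rcons in_cons xs orbT.
  move: cr; rewrite -sz (signed_ranks_extend (r := s) (x := - k%:Z)) ?abszN ?perm_rcons //;
    last exact: sorted_ge_rcons.
  rewrite sz mem_cat (IH k s).2 belowE k0 /=.
  by move: kr; rewrite mem_rcons inE negb_or => /andP[_ ->]; rewrite andbT.
split=> //.
have -> : (r \in (enum_signed_ranks n.+1 k).1) =
    (r \in [seq k%:Z :: s | s <- (enum_signed_ranks n k).1 ++ below]) ||
    (r \in (enum_signed_ranks n.+1 k).2) by rewrite mem_cat.
rewrite negE; apply/orP/idP => [[/mapP[s]|/and3P[]//]|cr].
  rewrite mem_cat (IH k s).1 belowE => hs ->.
  have sz : size s = n.
    by case/orP: hs => [/size_signed_ranks//|]; case: (k) => // k' /size_signed_ranks.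
  rewrite -sz (signed_ranks_extend (r := s) (x := k%:Z)) ?sz //.
  by rewrite sorted_ge_cons //; exact: le_signed_ranks.
have /signed_ranksP[sr tr ler hr] := cr.
have [kr|kr] := boolP (k%:Z \in r); last first.
  (* If k were 0, the first entry would be 0 and k would occur in [r]; so k is positive. *)
  right; rewrite cr /=; case: k kr ler {below belowE le_signed_ranks negE cr hr} => // kr ler.
  by case: r sr tr kr ler => // x r _ _; rewrite inE => + /(_ x); rewrite inE eqxx; lia.
left; case: r {negE} cr sr tr ler hr kr => // x s cr [sz] tr ler _ kr.
have xk : x = k%:Z.
  have := ler x (mem_head _ _).
  move: tr => /=; rewrite path_sortedE; last by move=> a b c /= ? ?; lia.
  by case/andP => /allP H _; move: kr; rewrite inE => /orP[/eqP//|/H /=]; lia.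
rewrite {x}xk in cr tr ler kr *; apply: map_f.
move: cr; rewrite -sz (signed_ranks_extend (r := s) (x := k%:Z)) //.
  by rewrite sz mem_cat (IH k s).1 belowE.
by apply: sorted_ge_cons => x xs; apply: ler; rewrite inE xs orbT.
Qed.

(** The concatenated lists are disjoint: level k occurs in sequences with parameter k but not in
    those with parameter k - 1, and the entry k separates front insertions from end insertions. *)
Lemma uniq_enum_signed_ranks n k :
  uniq (enum_signed_ranks n k).1 /\ uniq (enum_signed_ranks n k).2.
Proof.
elim: n k => [|n IH] k; first by case: k.
have hneg : uniq (enum_signed_ranks n.+1 k).2.
  rewrite /= map_inj_uniq; last by move=> r s /rcons_inj[].
  rewrite cat_uniq (IH k).2 /=; case: k => //= k; rewrite (IH k).1 andbT.
  apply/hasPn => r; rewrite (mem_enum_signed_ranks n k r).1 (mem_enum_signed_ranks n k.+1 r).2.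
  move=> /signed_ranksP[_ _ H _]; apply/negP => /and3P[/signed_ranksP[_ _ _ /(_ k.+1)]].
  by rewrite ltnSn => /(_ isT) /mapP[x /H] ? ?; lia.
split=> //.
have -> : uniq (enum_signed_ranks n.+1 k).1 =
    uniq ([seq k%:Z :: r | r <- (enum_signed_ranks n k).1 ++
            if k is k'.+1 then (enum_signed_ranks n k').1 else [::]] ++
          (enum_signed_ranks n.+1 k).2).
  by [].
rewrite cat_uniq hneg andbT; apply/andP; split; last first.
  apply/hasPn => r; rewrite (mem_enum_signed_ranks n.+1 k r).2 => /and3P[_ _ kr].
  by apply: contraNN kr => /mapP[s _ ->]; rewrite mem_head.
rewrite map_inj_uniq; last by move=> r s [].
rewrite cat_uniq (IH k).1 /=; case: k {hneg} => //= k; rewrite (IH k).1 andbT.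
apply/hasPn => r; rewrite (mem_enum_signed_ranks n k r).1 (mem_enum_signed_ranks n k.+1 r).1.
move=> /signed_ranksP[_ _ H _]; apply/negP => /signed_ranksP[_ _ _ /(_ k.+1)].
by rewrite ltnSn => /(_ isT) /mapP[x /H] ? ?; lia.
Qed.

(** * The generating function of the enumeration *)

(** With [ps_den] as [B], its few nonzero coefficients come first and can be peeled off the sums. *)
Lemma ps_mul_rev A B n k :
  ps_mul A B n k = \sum_(i < n.+1) \sum_(j < k.+1) A (n - i)%N (k - j)%N * B i j.
Proof.
rewrite /ps_mul (reindex_inj rev_ord_inj); apply: eq_bigr => i _ /=.
rewrite (reindex_inj rev_ord_inj); apply: eq_bigr => j _ /=.
by rewrite !subSS !subKn // -ltnS.
Qed.

(** Eliminating [h] from [gS] and [hS] gives g(n+2,k+1) = 2 g(n+1,k+1) - g(n,k+1) + 2 g(n+1,k) -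
    g(n,k), the recurrence read off from the denominator; small indices yield the numerator. *)
Lemma enum_signed_ranks_gf n k :
  ps_mul (fun a b => Posz (size (enum_signed_ranks a b).1)) ps_den n k = ps_num n k.
Proof.
pose g a b := size (enum_signed_ranks a b).1; pose h a b := size (enum_signed_ranks a b).2.
have h0 a : h a 0%N = 0%N by elim: a => // a; rewrite /h /= size_map cats0.
have g0 a : g a 0%N = 1%N.
  elim: a => // a; rewrite /g /= size_cat !size_map !size_cat addn0 => ->.
  by have := h0 a; rewrite /h => ->.
have hS a b : h a.+1 b.+1 = (h a b.+1 + g a b)%N by rewrite /h /g /= size_map size_cat.
have gS a b : g a.+1 b.+1 = (g a b.+1 + g a b + h a.+1 b.+1)%N.
  by rewrite hS /h /g /= size_cat !size_map !size_cat.
have g0S b : g 0%N b.+1 = 0%N by [].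
have h0S b : h 0%N b = 0%N by [].
rewrite -[ps_mul _]/(ps_mul (fun a b => Posz (g a b))) ps_mul_rev.
(* From here on [g] and [h] are abstract, known only through their recurrences. *)
move: g h {g0S} (g0S : forall b, g 0%N b.+1 = 0%N) h0 g0 hS gS h0S.
move=> g h g0S h0 g0 hS gS h0S.
case: n => [|[|n]]; case: k => [|k].
- by rewrite !big_ord_recl !big_ord0 /= g0.
- rewrite !big_ord_recl !big_ord0 /= subn0 !g0S big1 => [|j _]; by rewrite mulr0 ?mul0r ?addr0.
- by rewrite !big_ord_recl !big_ord0 /= !g0.
- rewrite !big_ord_recl !big_ord0 /= big1; last by move=> j _; rewrite mulr0.
  rewrite big1; last by move=> j _; rewrite mulr0.
  rewrite /bump ?subSS ?subn0 ?subnn /= gS hS.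
  case: k => [|k]; rewrite ?g0S ?h0S ?g0 /=; lia.
- rewrite !big_ord_recl !big_ord0 /= big1; last first.
    by move=> i _; rewrite big_ord_recl big_ord0 mulr0.
  by rewrite !g0.
- rewrite !big_ord_recl /= !big1;
    try by move=> j _; rewrite ?big_ord_recl ?big1 ?mulr0 // => i _; rewrite mulr0.
  rewrite ?subSS ?subn0 ?subnn /bump /= ?subSS ?subn0. rewrite !(gS, hS). lia.
Qed.

Lemma leq_index_sorted d (T : orderType d) (s : seq T) : sorted <%O s ->
  {in s &, forall x y, (index x s <= index y s)%N = (x <= y)%O}.
Proof.
move=> ss; have lt_index := sorted_ltn_index lt_trans ss.
move=> x y xs ys; case: (ltngtP (index x s)) => [/lt_index|/lt_index|/index_inj].
- by move=> /(_ xs ys)/ltW->.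
- by move=> /(_ ys xs); rewrite ltNge => /negbTE->.
- by move=> ->; rewrite ?lexx.
Qed.

(** * The type B forms, and faces as cones of points of the Weyl chamber *)

Section SignedForms.
Context (R : realType) (n : nat).
Implicit Types (p q x : 'rV[R]_n) (i j : 'I_n) (b : bool).

(** The case [i = j] with equal signs gives twice a signed coordinate, so the forms also record the
    signs of the coordinates. *)
Definition form (e : bool * 'I_n * bool * 'I_n) : 'rV[R]_n :=
  let: (b, i, b', j) := e in
  (-1) ^+ b *: delta_mx ord0 i + (-1) ^+ b' *: delta_mx ord0 j.

Lemma dotv_delta i x : dotv (delta_mx ord0 i) x = x ord0 i.
Proof.
rewrite /dotv (bigD1 i) //= big1 => [|j ji]; rewrite mxE ?eqxx /=.
  by rewrite mul1r addr0.
by rewrite (negPf ji) mul0r.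
Qed.

Lemma dotv_form b i b' j x : dotv (form (b, i, b', j)) x =
  (if b then - x ord0 i else x ord0 i) + (if b' then - x ord0 j else x ord0 j).
Proof.
rewrite dotvC dotvDr !dotvZr !(dotvC x) !dotv_delta.
by case: b; case: b'; rewrite ?expr1 ?expr0 ?mulN1r ?mul1r.
Qed.

Lemma formN e : exists e', form e' = - form e.
Proof.
case: e => [[[b i] b'] j]; exists (~~ b, i, ~~ b', j) => /=.
by rewrite opprD -!scaleNr !signrN.
Qed.

Lemma form_neq0 e x : dotv (form e) x != 0 -> form e != 0.
Proof. by apply: contraNneq => ->; rewrite dotv0l. Qed.

Definition weyl : set 'rV[R]_n :=
  [set x | forall i j, (i < j)%N -> x ord0 j <= x ord0 i].

(** Regularity for the differences x_i - x_j makes the weak Weyl inequalities strict, so the walls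
    of the chamber can be treated as hyperplanes of the arrangement. *)
Lemma open_partE : @open_part R n = weyl `&` regular form.
Proof.
apply/seteqP; split=> x [xlt xneq]; split.
- by move=> i j /xlt /ltW.
- have neqD i j : x ord0 i + x ord0 j != 0.
    by case: (leqP i j) => [/xneq//|/ltnW/xneq]; rewrite addrC.
  move=> [[[b i] b'] j] e0.
  have neqB : b != b' -> x ord0 i != x ord0 j.
    move=> bb'; case: (ltngtP i j) => [/xlt/gt_eqF->//|/xlt/lt_eqF->//|/val_inj ij].
    case/eqP: e0; rewrite /form ij -scalerDl; case: b b' bb' => -[] //= _.
      by rewrite expr0 expr1 addNr scale0r.
    by rewrite expr0 expr1 subrr scale0r.
  rewrite dotv_form; case: b b' neqB {e0} => -[] //= neqB.
  + by rewrite -opprD oppr_eq0.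
  + by rewrite addrC subr_eq0 eq_sym neqB.
  + by rewrite subr_eq0 neqB.
- move=> i j ij; rewrite lt_neqAle xlt // andbT.
  have := xneq (false, i, true, j); rewrite dotv_form subr_eq0 [x _ j == _]eq_sym; apply.
  apply: (@form_neq0 _ (delta_mx ord0 i)); rewrite dotv_form !mxE !eqxx /=.
  by rewrite (_ : (j == i) = false) ?subr0 ?oner_eq0 // -val_eqE gtn_eqF.
- move=> i j _; have := xneq (false, i, false, j); rewrite dotv_form; apply.
  by apply: (@form_neq0 _ (const_mx 1)); rewrite dotv_form !mxE -(natrD _ 1 1) pnatr_eq0.
Qed.

Lemma cone_weyl p x : weyl p -> cone form p x -> weyl x.
Proof.
move=> wp px i j /wp ij; have := px (false, i, true, j).
by rewrite !dotv_form !subr_ge0; exact.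
Qed.

Lemma chamberE p : @open_part R n p ->
  closure (connected_component (@open_part R n) p) = cone form p.
Proof.
move=> op; have := op; rewrite open_partE => -[wp rp]; apply: closure_component => //.
move=> x px; split=> [i j ij|e /rp].
  have := px (false, i, true, j); rewrite !dotv_form !subr_gt0 => H.
  apply/ltW/H; by have [/(_ _ _ ij)] := op.
rewrite neq_lt => /orP[pe|/px/gt_eqF->//].
have [e' ee'] := formN e; have := px e'.
by rewrite ee' !dotvNl !oppr_gt0 => /(_ pe) /lt_eqF ->.
Qed.

Lemma exists_open_part : exists r, @open_part R n r.
Proof.
exists (\row_i (n - i)%:R); split=> i j ij; rewrite !mxE.
  by rewrite ltr_nat ltn_sub2l // ltn_ord.
by rewrite -natrD pnatr_eq0 -lt0n addn_gt0 subn_gt0 ltn_ord.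
Qed.

Lemma faceE F : is_face F <-> exists2 q, weyl q & F = cone form q.
Proof.
split=> [[_ [p op ->]]|[q wq ->]].
  rewrite (chamberE op); move: op; rewrite open_partE => -[wp rp].
  case=> [->|[a [_ ap ->]]]; first by exists p.
  have [q pq ->] := regular_face formN rp ap.
  by exists q => //; exact: cone_weyl pq.
(* A small push of [q] along a point [r] of the open part makes it regular without leaving the Weyl
   chamber. *)
have [r] := exists_open_part; rewrite open_partE => -[wr rr].
have [p [rp pq Hp]] := regular_perturb formN q rr.
have op : open_part p.
  rewrite open_partE; split=> // i j ij.
  have := Hp (false, i, true, j); rewrite !dotv_form !subr_ge0; apply; [exact: wq|exact: wr].
exists (cone form p); first by exists p; rewrite ?chamberE.
exact: (face_of_regular formN rp pq).
Qed.

End SignedForms.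

(** * Normal forms of cones and the dimension of their spans *)

Section Representatives.
Context (R : realType) (n : nat).
Implicit Types (q x : 'rV[R]_n) (r : seq int) (i j : 'I_n).
Notation cone := (cone (@form R n)).

Definition vec r : 'rV[R]_n := \row_i (r`_i)%:~R.

Lemma dotv_form_vec b i b' j r : dotv (form R (b, i, b', j)) (vec r) =
  ((if b then - r`_i else r`_i) + (if b' then - r`_j else r`_j))%:~R.
Proof. by rewrite dotv_form !mxE; case: b; case: b'; rewrite rmorphD /= ?rmorphN. Qed.

Lemma signed_ranks_weyl k r : signed_ranks n k r -> weyl (vec r).
Proof.
move=> /signed_ranksP[sr tr _ _] i j ij; rewrite !mxE ler_int.
have ge_trans : transitive (>=%R : rel int) by move=> a b c /= ? ?; lia.
have ge_refl : reflexive (>=%R : rel int) by move=> a /=.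
apply: (sorted_leq_nth ge_trans ge_refl 0 tr); rewrite ?inE ?sr //; exact: ltnW.
Qed.

Lemma signed_ranks_level k r (c : nat) : signed_ranks n k r -> (0 < c <= k)%N ->
  exists i, absz r`_i = c.
Proof.
move=> /signed_ranksP[sr _ _ H] /H /(nthP 0%N)[i]; rewrite size_map sr => ir.
by rewrite (nth_map 0) ?sr // => <-; exists (Ordinal ir).
Qed.

Lemma signed_ranks_abs_le k r i : signed_ranks n k r -> (absz (r`_i)%R <= k)%N.
Proof. by move=> /signed_ranksP[sr _ H _]; apply: H; rewrite mem_nth ?sr. Qed.

(* Each level [c.+1] of [r] lies strictly above an entry of level [c], and strict
   inequalities transfer from [r] to [r']. *)
Lemma signed_ranks_cone_abs k r r' i : signed_ranks n k r -> cone (vec r') (vec r) ->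
  (absz (r`_i)%R <= absz (r'`_i)%R)%N.
Proof.
move=> cr rr'.
have H b j b' l := rr' (b, j, b', l).
have {}H b j b' (l : 'I_n) :
    0 <= (if b then - r'`_j else r'`_j) + (if b' then - r'`_l else r'`_l) ->
    0 <= (if b then - r`_j else r`_j) + (if b' then - r`_l else r`_l).
  by have := H b j b' l; rewrite !dotv_form_vec !ler0z.
have [c] := ubnP (absz r`_i); elim: c i => // c IH i ic.
have := H false i false i; have := H true i true i.
have [c0 ?|c0] := eqVneq (absz r`_i).-1 0%N; first lia.
have [|j jc] := @signed_ranks_level k r (absz r`_i).-1 cr.
  by have := signed_ranks_abs_le i cr; lia.
have := IH j; rewrite jc.
have := H false i false j; have := H true i true j.
have := H true i false j; have := H false i true j.
clear H IH rr' cr; move: (r`_i) (r`_j) (r'`_i) (r'`_j) c0 jc ic => /=; lia.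
Qed.

(** Comparing both ways gives equal absolute values; the forms with [i = j] then give equal
    signs. *)
Lemma signed_ranks_cone_inj k k' r r' : signed_ranks n k r -> signed_ranks n k' r' ->
  cone (vec r) = cone (vec r') -> r = r'.
Proof.
move=> cr cr' rr'.
have h1 : cone (vec r') (vec r) by rewrite -rr'; exact: cone_refl.
have h2 : cone (vec r) (vec r') by rewrite rr'; exact: cone_refl.
have [sr _ _ _] := signed_ranksP _ _ _ cr; have [sr' _ _ _] := signed_ranksP _ _ _ cr'.
apply: (@eq_from_nth _ 0) => [|i]; rewrite sr ?sr' // => ir.
have /= := signed_ranks_cone_abs (Ordinal ir) cr h1.
have /= := signed_ranks_cone_abs (Ordinal ir) cr' h2.
have := h1 (false, Ordinal ir, false, Ordinal ir).
have := h1 (true, Ordinal ir, true, Ordinal ir).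
rewrite !dotv_form_vec !ler0z /=; lia.
Qed.

Lemma eq_cone q x : (forall e, (0 <= dotv (form R e) q) = (0 <= dotv (form R e) x)) ->
  cone q = cone x.
Proof. by move=> H; apply/seteqP; split=> y qy e; have := qy e; rewrite H. Qed.

(** The cone depends only on the signs of the sums of two signed coordinates, which an odd
    increasing map of the values preserves; the signed rank is such a map. *)
Lemma exists_signed_ranks q : weyl q ->
  exists k, exists2 r, signed_ranks n k r & cone q = cone (vec r).
Proof.
move=> wq.
pose s : seq R := sort <=%R (undup (0 :: [seq `|q ord0 i| | i <- enum 'I_n])).
have sorts : sorted <%R s by rewrite sort_lt_sorted undup_uniq.
have ms y : (y \in s) = (y == 0) || (y \in [seq `|q ord0 i| | i <- enum 'I_n]).
  by rewrite mem_sort mem_undup inE.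
have s0 : 0 \in s by rewrite ms eqxx.
have sq i : `|q ord0 i| \in s.
  by rewrite ms; apply/orP; right; apply/mapP; exists i; rewrite ?mem_enum.
have sge0 y : y \in s -> 0 <= y.
  by rewrite ms => /orP[/eqP->//|/mapP[i _ ->]].
pose rk y := index y s.
have rkle y z : y \in s -> z \in s -> (rk y <= rk z)%N = (y <= z).
  by move=> ys zs; exact: leq_index_sorted.
have rk0 : rk 0 = 0%N.
  have : (0 < size s)%N by case: (s) s0.
  move=> sz; have := rkle 0 (s`_0) s0 (mem_nth _ sz).
  rewrite [rk s`_0]index_uniq ?(lt_sorted_uniq sorts) // leqn0.
  by rewrite sge0 ?mem_nth // => /eqP.
pose psi (y : R) : int := if y < 0 then - (rk `|y|)%:Z else (rk `|y|)%:Z.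
have psiN y : psi (- y) = - psi y.
  rewrite /psi normrN; case: (ltgtP y 0) => [y0|y0|->].
  - by rewrite oppr_lt0 ltNge (ltW y0) /= opprK.
  - by rewrite oppr_lt0 y0.
  - by rewrite oppr0 ltxx normr0 rk0.
have psile y z : `|y| \in s -> `|z| \in s -> (psi y <= psi z) = (y <= z).
  move=> ys zs; rewrite /psi; case: (ltP y 0) => y0; case: (ltP z 0) => z0.
  - by rewrite lerN2 lez_nat rkle // (ltr0_norm y0) (ltr0_norm z0) lerN2.
  - by rewrite (ltW (lt_le_trans y0 z0)); lia.
  - have := rkle _ _ zs s0.
    have -> : (y <= z) = false by rewrite leNgt (lt_le_trans z0 y0).
    rewrite rk0 normr_le0 (lt_eqF z0). move: (rk `|z|) (rk `|y|) => a b. lia.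
  - by rewrite lez_nat rkle // (ger0_norm y0) (ger0_norm z0).
(* Nonnegativity of y + z is the comparison of - z with y, to which oddness and monotonicity of
   [psi] apply. *)
have psiD y z : `|y| \in s -> `|z| \in s -> (0 <= psi y + psi z) = (0 <= y + z).
  move=> ys zs; rewrite -[z in RHS]opprK subr_ge0 -psile ?normrN // psiN; lia.
pose r := [seq psi (q ord0 i) | i <- enum 'I_n].
have rE i : r`_i = psi (q ord0 i).
  by rewrite (nth_map i) ?nth_ord_enum // size_enum_ord.
(* The value 0 takes rank 0 in [s], so the largest rank is one less than the size. *)
exists (size s).-1, r; last first.
  apply: eq_cone => -[[[b i] b'] j]; rewrite dotv_form_vec dotv_form ler0z !rE.
  rewrite -psiD; [|by case: b; rewrite ?normrN sq|by case: b'; rewrite ?normrN sq].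
  by case: b; case: b'; rewrite ?psiN.
apply/signed_ranksP; split.
- by rewrite size_map size_enum_ord.
- rewrite (sorted_pairwise); last by move=> a b c /= ? ?; lia.
  apply/(pairwiseP 0) => i j; rewrite !inE size_map size_enum_ord => hi hj ij.
  rewrite -[i]/(val (Ordinal hi)) -[j]/(val (Ordinal hj)) !rE /= psile //.
  exact: wq.
- move=> _ /mapP[i _ ->].
  have : (rk `|q ord0 i|%R < size s)%N by rewrite index_mem.
  by rewrite /psi; move: (rk _) => a; case: ifP; lia.
- move=> c /andP[c0 cs].
  have cs' : (c < size s)%N by lia.
  have : s`_c \in s by rewrite mem_nth.
  have rkc : rk s`_c = c by rewrite /rk index_uniq // (lt_sorted_uniq sorts).
  rewrite ms => /orP[/eqP sc|/mapP[i _ sc]].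
    by move: rkc; rewrite sc rk0 => c00; rewrite -c00 in c0.
  apply/mapP; exists (psi (q ord0 i)); first by apply/mapP; exists i; rewrite ?mem_enum.
  by rewrite /psi -sc rkc; case: ifP; lia.
Qed.

(** Applied entrywise to [r] for m from 1 to k, it gives vectors with disjoint nonempty supports: a
    basis of the span of [cone (vec r)]. *)
Definition level (m : nat) (z : int) : int := if absz z == m then sgz z else 0.

Lemma nth_level m r i : (map (level m) r)`_i = level m r`_i.
Proof.
have [ir|ir] := ltnP i (size r); first by rewrite (nth_map 0).
by rewrite !nth_default ?size_map // /level sgz0; case: ifP.
Qed.

Lemma span_dim_cone k r : signed_ranks n k r -> span_dim (cone (vec r)) k.
Proof.
move=> cr.
pose T : k.-tuple 'rV[R]_n := [tuple vec (map (level c.+1) r) | c < k].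
have TE (c : 'I_k) i : T`_c ord0 i = (level c.+1 r`_i)%:~R.
  by rewrite /T (nth_mktuple _ _ c) mxE nth_level.
have /fin_all_exists[f fE] : forall c : 'I_k, exists i : 'I_n, absz r`_i = c.+1.
  by move=> c; apply: (signed_ranks_level cr); rewrite /=.
have Tsub (c : 'I_k) e : dotv (form R e) (vec r) = 0 -> dotv (form R e) T`_c = 0.
  case: e => [[[b i] b'] j]; rewrite dotv_form_vec dotv_form !TE.
  move=> /eqP; rewrite intr_eq0 => H.
  have : (if b then - level c.+1 r`_i else level c.+1 r`_i) +
         (if b' then - level c.+1 r`_j else level c.+1 r`_j) == 0.
    by move: H; rewrite /level; case: b; case: b'; do 2 case: ifP; case: sgzP; case: sgzP; lia.
  by rewrite -(intr_eq0 R) rmorphD /=; case: b {H}; case: b'; rewrite ?rmorphN => /eqP.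
exists <<T>>%VS; split.
- move=> x rx.
  (* The forms vanishing at [vec r] vanish at [x], so on each level [x] is constant up to the signs
     of [r]; the constant is read off at coordinate [f c]. *)
  have -> : x = \sum_(c < k) ((sgz r`_(f c))%:~R * x ord0 (f c)) *: T`_c.
    apply/rowP => i; rewrite summxE.
    have H b b' c := @cone_eq0 _ _ _ _ (@formN R n) _ _ (b, i, b', f c) rx.
    have H0 := @cone_eq0 _ _ _ _ (@formN R n) _ _ (false, i, false, i) rx.
    have [i0|i0] := eqVneq r`_i 0.
      rewrite big1 => [|c _]; last by rewrite !mxE TE i0 /level; rewrite mulr0.
      move: H0; rewrite dotv_form_vec dotv_form i0 => /(_ erefl). lra.
    have [c cE] : exists c : 'I_k, absz r`_i = c.+1.
      have ck : ((absz (r`_i)%R).-1 < k)%N.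
        move: i0 (signed_ranks_abs_le i cr); move: (r`_i) => z; lia.
      by exists (Ordinal ck); rewrite /= prednK // absz_gt0.
    rewrite (bigD1 c) //= big1 => [|l lc]; last first.
      rewrite !mxE TE /level cE ifF ?mulr0 // eqSS; apply: contraNF lc.
      by rewrite eq_sym => /eqP/val_inj->.
    rewrite mxE TE addr0 /level cE eqxx.
    have hD : r`_i + r`_(f c) = 0 -> x ord0 i + x ord0 (f c) = 0.
      by move=> e; have := H false false c; rewrite dotv_form_vec dotv_form e; exact.
    have hB : r`_i - r`_(f c) = 0 -> x ord0 i - x ord0 (f c) = 0.
      by move=> e; have := H false true c; rewrite dotv_form_vec dotv_form e; exact.
    move: (fE c) hD hB; rewrite -cE; move: i0 {cE}.
    move: (r`_i) (r`_(f c)) => u v u0 uv hD hB.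
    rewrite -[x 0 i]/(x ord0 i); case: (sgzP u) u0 => // u1 _; case: (sgzP v) => v1.
    - lia.
    - have := hB ltac:(lia); lra.
    - have := hD ltac:(lia); lra.
    - lia.
    - have := hD ltac:(lia); lra.
    - have := hB ltac:(lia); lra.
  by apply: memv_suml => c _; apply: memvZ; apply: memv_span; rewrite mem_nth ?size_tuple.
- move=> V rV; apply/span_subvP => u /(nthP 0)[c]; rewrite size_tuple => ck <-.
  (* A subspace containing the cone contains [vec r] and its translate by a positive multiple of the
     basis vector, hence their difference. *)
  have [d d0 rd] := perturb_cone (Tsub (Ordinal ck)).
  have : d *: T`_c \in V.
    by rewrite -[d *: _](addrK (vec r)) addrC addrA -addrA addrC memvB // rV // addrC.
  by move=> /(memvZ d^-1); rewrite scalerA mulVf ?gt_eqF // scale1r.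
(* At coordinate [f c] only the basis vector of index [c] is nonzero, which isolates its
   coefficient. *)
- apply/eqP; rewrite -[X in _ == X](size_tuple T); apply/freeP => a a0 c.
  move/rowP: a0 => /(_ (f c)); rewrite summxE mxE (bigD1 c) //= big1 => [|l lc].
    rewrite mxE TE addr0 /level fE eqxx => /eqP; rewrite mulf_eq0 intr_eq0 sgz_eq0.
    by case/orP => [/eqP//|/eqP fc]; have := fE c; rewrite fc.
  rewrite mxE TE /level fE ifF ?mulr0 // eqSS; apply: contraNF lc.
  by rewrite eq_sym => /eqP/val_inj->.
Qed.

End Representatives.

(** * Counting the faces of each dimension *)

Lemma span_dim_uniq (R : realType) n (S : set 'rV[R]_n) k l :
  span_dim S k -> span_dim S l -> k = l.
Proof.
move=> [U [SU Umin <-]] [V [SV Vmin <-]].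
by congr (\dim _); apply: subv_anti; rewrite Umin ?Vmin.
Qed.

(* g(n,k) = number of k-faces; G(s,t) * (1-2s+s^2-2st+s^2 t) = 1 - s,
   i.e. G = (1-s)/(1-2s+s^2-2st+s^2 t) since the denominator is invertible. *)
Theorem theorem1p4 (R : realType) :
  exists g : nat -> nat -> nat,
    (forall n k, kface_count R n k (g n k)) /\
    (forall n k, ps_mul (fun a b => Posz (g a b)) ps_den n k = ps_num n k).
Proof.
exists (fun n k => size (enum_signed_ranks n k).1); split; last exact: enum_signed_ranks_gf.
move=> n k; pose E := (enum_signed_ranks n k).1.
have cE (i : 'I_(size E)) : signed_ranks n k (nth [::] E i).
  by rewrite -(mem_enum_signed_ranks n k _).1 mem_nth.
exists (fun i => cone (@form R n) (vec R n (nth [::] E i))); split=> [i j ij|F].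
  apply/val_inj/eqP; rewrite -(nth_uniq [::] (ltn_ord i) (ltn_ord j) (uniq_enum_signed_ranks n k).1).
  by apply/eqP; exact: signed_ranks_cone_inj ij.
split=> [[/faceE[q wq ->] dq]|[i ->]]; last first.
  split; last exact: span_dim_cone.
  by apply/faceE; eexists; first exact: signed_ranks_weyl (cE i).
have [l [r cr qr]] := exists_signed_ranks wq.
rewrite qr in dq *.
(* The number of levels of the normal form is forced to be k by the dimension of the span. *)
have kl := span_dim_uniq dq (span_dim_cone R cr); rewrite -kl in cr.
have rE : r \in E by rewrite (mem_enum_signed_ranks n k r).1.
have ri : (index r E < size E)%N by rewrite index_mem.
by exists (Ordinal ri); rewrite /= nth_index.
Qed.
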